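(* Let $R$ be a finite commutative ring with identity of odd characteristic and let $n\ge 2$ be an integer. Let $\{M_k:1\le k\le 2n-1\}$ be a partition of the set $\{\{i,j\}:1\le i\neq j\le 2n\}$ of unordered pairs such that, for every $k$, $|M_k|=n$, $\alpha\cap\beta=\emptyset$ for all $\alpha,\beta\in M_k$ with $\alpha\ne\beta$, and $\{k,2n\}\in M_k$. Put $M'_k=M_k\setminus\{\{k,2n\}\}$. Then $\mathfrak{so}_{2n-1}(R)$ has an ODAC $$\mathfrak{so}_{2n-1}(R)=H'_1\oplus H'_2\oplus\cdots\oplus H'_{2n-1},$$ where $H'_k=\langle X_{(i,j)} : \{i,j\}\in M'_k\rangle_R$.
   Context: $X_{(i,j)}=e_{ij}-e_{ji}$, where $e_{ij}$ is the $(2n-1)\times(2n-1)$ matrix over $R$ with $1$ in position $(i,j)$ and $0$ elsewhere; $\mathfrak{so}_{2n-1}(R)=\langle X_{(i,j)} : 1\le i\ne j\le 2n-1\rangle_R$ with bracket $[A,B]=AB-BA$, and $\langle\cdot\rangle_R$ denotes $R$-span. Let $L$ be a Lie algebra over $R$ that is free of finite rank as an $R$-module. A Cartan subalgebra of $L$ is a nilpotent subalgebra $H$ that equals its normalizer $N_L(H)=\{x\in L:[x,H]\subseteq H\}$. The Killing form is $K(A,B)=\operatorname{Tr}(\operatorname{ad}A\cdot\operatorname{ad}B)$. An ODAC (orthogonal decomposition into abelian Cartan subalgebras) of $L$ is a direct sum decomposition of $R$-modules of $L$ into finitely many abelian Cartan subalgebras that are pairwise orthogonal with respect to the Killing form.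 *)

(* Defs.v *)
From HB Require Import structures.
From mathcomp Require Import all_boot all_order all_algebra.
From mathcomp Require Import boolp classical_sets.
From mathcomp Require Import ring.

Set Implicit Arguments.
Unset Strict Implicit.
Unset Printing Implicit Defensive.

Import GRing.Theory.
Local Open Scope ring_scope.
Local Open Scope classical_set_scope.

(* c is the nonnegative generator of the kernel of the ring morphism from the
   integers to R (mathcomp's [pchar R] only records a prime characteristic). *)
Definition has_char (R : nzRingType) (c : nat) : Prop :=
  forall m : nat, (m%:R == 0 :> R) = (c %| m)%N.

Definition lspan (R : nzRingType) (V : lmodType R) (S : set V) : set V :=
  [set x | exists (n : nat) (c : 'I_n -> R) (v : 'I_n -> V),
     (forall i, S (v i)) /\ x = \sum_i c i *: v i].

Lemma lspan_submod_closed (R : nzRingType) (V : lmodType R) (S : set V) :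
  submod_closed [in lspan S].
Proof.
split; first by rewrite inE; exists 0%N, (fun=> 0), (fun=> 0);
  split; [case | rewrite big_ord0].
move=> a x y; rewrite !inE => -[n1 [c1 [v1 [S1 ->]]]] [n2 [c2 [v2 [S2 ->]]]].
exists (n1 + n2)%N.
exists (fun i => match split i with inl j => a * c1 j | inr j => c2 j end).
exists (fun i => match split i with inl j => v1 j | inr j => v2 j end).
split=> [i|]; first by case: (split i).
rewrite big_split_ord /= scaler_sumr; congr (_ + _); apply: eq_bigr => i _.
  by rewrite (unsplitK (inl i)) scalerA.
by rewrite (unsplitK (inr i)).
Qed.

Lemma lspan_gen (R : nzRingType) (V : lmodType R) (S : set V) x :
  S x -> x \in lspan S.
Proof.
move=> Sx; rewrite inE; exists 1%N, (fun=> 1), (fun=> x).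
by split=> //; rewrite big_ord1 scale1r.
Qed.

Lemma lspan_sum (R : nzRingType) (V : lmodType R) (S : set V) (I : finType)
    (c : I -> R) (v : I -> V) :
  (forall i, S (v i)) -> \sum_i c i *: v i \in lspan S.
Proof.
have [S0 Slin] := lspan_submod_closed S => vS.
elim/big_rec: _ => // i x _ xS; apply: Slin xS; exact: lspan_gen (vS i).
Qed.

HB.mixin Record Lmodule_isLie (R : comNzRingType) L of GRing.Lmodule R L := {
  bracket : L -> L -> L;
  bracket_linearl : forall y : L, linear (bracket^~ y);
  bracket_linearr : forall x : L, linear (bracket x);
  bracketxx : forall x : L, bracket x x = 0;
  bracket_jacobi : forall x y z : L,
    bracket x (bracket y z) + bracket y (bracket z x)
      + bracket z (bracket x y) = 0
}.

#[short(type="lieAlgType")]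
HB.structure Definition Lie (R : comNzRingType) :=
  { L of Lmodule_isLie R L & GRing.Lmodule R L }.

(* vectType over a ring means linearly isomorphic to some 'rV_n, that is,
   free of finite rank. *)
#[short(type="freeLieAlgType")]
HB.structure Definition FreeLie (R : comNzRingType) :=
  { L of Lmodule_isLie R L & Vector R L }.

Section LieAlgebra.
Variables (R : comNzRingType) (L : lieAlgType R).
Implicit Types (H : set L) (x y : L).

Definition lie_subalgebra H : Prop :=
  submod_closed [in H] /\ (forall x y, H x -> H y -> H (bracket x y)).

Fixpoint lower_central H (k : nat) : set L :=
  if k is k'.+1 then
    lspan [set z | exists x y, [/\ H x, lower_central H k' y & z = bracket x y]]
  else H.

Definition lie_nilpotent H : Prop := exists k, lower_central H k = [set 0].

Definition lie_normalizer H : set L :=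
  [set x | forall y, H y -> H (bracket x y)].

Definition cartan_subalgebra H : Prop :=
  [/\ lie_subalgebra H, lie_nilpotent H & lie_normalizer H = H].

Definition lie_abelian H : Prop :=
  forall x y, H x -> H y -> bracket x y = 0.

Definition direct_sum_decomposition (I : finType) (H : I -> set L) : Prop :=
  forall x, exists! h : {ffun I -> L},
    (forall i, H i (h i)) /\ x = \sum_i h i.

End LieAlgebra.

Section Killing.
Import VectorInternalTheory.
Variables (R : comNzRingType) (L : freeLieAlgType R).

(* Trace of the matrix of f in the basis of L given by the coordinate
   isomorphism v2r (with inverse r2v). *)
Definition ltrace (f : L -> L) : R := \tr (lin1_mx (v2r \o f \o r2v)).

Definition ad (x : L) : L -> L := bracket x.

Definition killing (x y : L) : R := ltrace (ad x \o ad y).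

Definition is_ODAC (I : finType) (H : I -> set L) : Prop :=
  [/\ direct_sum_decomposition H,
      forall i, cartan_subalgebra (H i),
      forall i, lie_abelian (H i)
    & forall i j, i != j ->
        forall x y, H i x -> H j y -> killing x y = 0].

End Killing.

Definition Xmx (R : nzRingType) (m : nat) (i j : 'I_m) : 'M[R]_m :=
  delta_mx i j - delta_mx j i.

Definition so_span (R : nzRingType) (m : nat) : set 'M[R]_m :=
  lspan [set A | exists i j : 'I_m, i != j /\ A = Xmx R i j].

Record so (R : nzRingType) (m : nat) :=
  So { so_mx :> 'M[R]_m; _ : so_mx \in @so_span R m }.

HB.instance Definition _ R m := [isSub of so R m for @so_mx R m].
HB.instance Definition _ R m := [Choice of so R m by <:].
HB.instance Definition _ (R : nzRingType) (m : nat) :=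
  GRing.SubChoice_isSubLmodule.Build R 'M[R]_m _ (so R m)
    (GRing.submod_closed_semi (lspan_submod_closed _)).

Section SoBasis.
Variables (R : nzRingType) (m : nat).
Implicit Types A B : 'M[R]_m.

Definition so_index : finType := {p : 'I_m * 'I_m | (p.1 < p.2)%N}.

Definition so_coord A : {ffun so_index -> R} :=
  [ffun p => A (val p).1 (val p).2].

Definition so_comb (c : so_index -> R) : 'M[R]_m :=
  \sum_p c p *: Xmx R (val p).1 (val p).2.

Lemma so_comb_in c : so_comb c \in @so_span R m.
Proof.
apply: lspan_sum => -[[i j] /= ij]; exists i, j; split=> //.
by apply: contraTneq ij => ->; rewrite ltnn.
Qed.

Lemma so_span_alt A :
  A \in @so_span R m -> (forall i, A i i = 0) /\ (forall i j, A j i = - A i j).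
Proof.
rewrite inE => -[n [c [v [vP ->]]]].
have vE k : (forall i, v k i i = 0) /\ (forall i j, v k j i = - v k i j).
  have [a [b [_ ->]]] := vP k.
  split=> [i|i j]; rewrite !mxE; first by rewrite [(i == b) && _]andbC subrr.
  by rewrite opprB [(j == a) && _]andbC [(j == b) && _]andbC.
split=> [i|i j]; rewrite !summxE.
  by apply: big1 => k _; rewrite mxE (vE k).1 mulr0.
by rewrite -sumrN; apply: eq_bigr => k _; rewrite !mxE (vE k).2 mulrN.
Qed.

Lemma so_combK c (p : so_index) : so_coord (so_comb c) p = c p.
Proof.
rewrite ffunE summxE (bigD1 p) //= big1 ?addr0 => [|q qp].
  case: p => [[a b] /= ab]; rewrite !mxE !eqxx /=.
  suff /negbTE-> : a != b by rewrite subr0 mulr1.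
  by apply: contraTneq ab => ->; rewrite ltnn.
rewrite !mxE; case: p q qp => [[a b] /= ab] [[a' b'] /= ab'].
rewrite -val_eqE /= -pair_eqE /pair_eq /= [a' == _]eq_sym [b' == _]eq_sym.
move=> /negbTE->; suff -> : (a == b') && (b == a') = false by rewrite subrr mulr0.
apply/negP=> /andP[/eqP ea /eqP eb]; move: ab; rewrite ea eb.
by rewrite ltnNge ltnW.
Qed.

Lemma so_coord_inj A B :
    (forall i, A i i = 0) -> (forall i j, A j i = - A i j) ->
  B \in @so_span R m -> so_coord A = so_coord B -> A = B.
Proof.
move=> A0 AN /so_span_alt[B0 BN] AB.
have ltE (i j : 'I_m) : (i < j)%N -> A i j = B i j.
  by move=> ij; have /ffunP/(_ (exist _ (i, j) ij)) := AB; rewrite !ffunE.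
apply/matrixP=> i j; case: (ltngtP i j) => [/ltE //|/ltE ji|/val_inj->].
  by rewrite AN ji -BN.
by rewrite A0 B0.
Qed.

Lemma so_spanP A :
  reflect ((forall i, A i i = 0) /\ (forall i j, A j i = - A i j))
          (A \in @so_span R m).
Proof.
apply: (iffP idP) => [|[A0 AN]]; first exact: so_span_alt.
rewrite (so_coord_inj A0 AN (so_comb_in (so_coord A))) ?so_comb_in //.
by apply/ffunP=> p; rewrite so_combK.
Qed.

Lemma so_vector_axiom : Vector.axiom #|so_index| (so R m).
Proof.
exists (fun A : so R m => \row_t so_coord A (enum_val t)).
  by move=> a A B; apply/rowP=> t; rewrite !mxE !ffunE !mxE.
exists (fun u : 'rV[R]_#|so_index| =>
          So (so_comb_in (fun p => u 0 (enum_rank p)))) => [A|u].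
  apply: val_inj => /=; have [A0 AN] := so_span_alt (valP A).
  apply/esym/so_coord_inj=> //; first exact: so_comb_in.
  by apply/ffunP=> p; rewrite so_combK mxE enum_rankK.
by apply/rowP=> t; rewrite mxE so_combK enum_valK.
Qed.

HB.instance Definition _ :=
  Lmodule_hasFinDim.Build R (so R m) so_vector_axiom.

End SoBasis.

Section SoLie.
Variables (R : comNzRingType) (m : nat).
Implicit Types x y z : so R m.

Lemma so_bracket_in x y : x *m y - y *m x \in @so_span R m.
Proof.
have [x0 xN] := so_span_alt (valP x); have [y0 yN] := so_span_alt (valP y).
apply/so_spanP; split=> [i|i j]; rewrite !mxE -!sumrB -?sumrN.
  by apply: big1 => k _; rewrite (xN i k) (yN i k); ring.
by apply: eq_bigr => k _; rewrite (xN k j) (yN i k) (yN k j) (xN i k); ring.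
Qed.

Definition so_bracket x y : so R m := So (so_bracket_in x y).

Lemma so_bracket_linearl y : linear (so_bracket^~ y).
Proof.
move=> a x z; apply: val_inj; rewrite /= mulmxDl mulmxDr -scalemxAl -scalemxAr.
by rewrite scalerBr opprD addrACA.
Qed.

Lemma so_bracket_linearr x : linear (so_bracket x).
Proof.
move=> a y z; apply: val_inj; rewrite /= mulmxDl mulmxDr -scalemxAl -scalemxAr.
by rewrite scalerBr opprD addrACA.
Qed.

Lemma so_bracketxx x : so_bracket x x = 0.
Proof. by apply: val_inj; rewrite /= subrr. Qed.

Lemma so_bracket_jacobi x y z :
  so_bracket x (so_bracket y z) + so_bracket y (so_bracket z x)
    + so_bracket z (so_bracket x y) = 0.
Proof.
apply: val_inj; rewrite /= !(mulmxBl, mulmxBr) !mulmxA.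
by apply/matrixP=> i j; rewrite !mxE; ring.
Qed.

HB.instance Definition _ :=
  Lmodule_isLie.Build R (so R m) so_bracket_linearl so_bracket_linearr
    so_bracketxx so_bracket_jacobi.

End SoLie.

Lemma so_bracketE (R : comNzRingType) (m : nat) (x y : so R m) :
  bracket x y = x *m y - y *m x :> 'M[R]_m.
Proof. by []. Qed.

Section PairPartition.
Variables (m : nat) (M : 'I_m -> {set {set 'I_m.+1}}).

(* The points 1, ..., m + 1 are the elements 0, ..., m of 'I_m.+1; the last one
   is ord_max, and the matrix indices 'I_m are the points below it. *)
Definition pt (i : 'I_m) : 'I_m.+1 := lift ord_max i.

Definition Mprime (k : 'I_m) : {set {set 'I_m.+1}} :=
  (M k :\ [set pt k; ord_max])%SET.

Definition Hprime (R : nzRingType) (k : 'I_m) : set (so R m) :=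
  lspan [set x | exists i j : 'I_m,
    [set pt i; pt j]%SET \in Mprime k /\ so_mx x = Xmx R i j].

End PairPartition.

(* Main.v *)
From HB Require Import structures.
Require Import Defs.
From mathcomp Require Import all_boot all_order all_algebra.
From mathcomp Require boolp classical_sets.

(** Write i ~k j when the pair {i, j} belongs to M_k. Then H'_k is the set of
    skew-symmetric matrices supported on ~k, and the relations ~k split the
    off-diagonal positions, which gives the direct sum. Each ~k is a matching,
    so a product of two matrices in H'_k is diagonal and H'_k is abelian. The
    matching misses only the point k: if j ~k i, then the row i of
    [x, X_(j,i)] contains the entries of the row j of x, so a matrix x
    normalizing H'_k vanishes off ~k. Finally the (p, q) coordinate of
    [A, [B, X_(p,q)]], for p < q, is (AB)_pp + (BA)_qq + 2 A_pq B_pq, which is 0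
    when A and B have disjoint supports. *)

Set Implicit Arguments.
Unset Strict Implicit.
Unset Printing Implicit Defensive.

Import GRing.Theory.

(** * Traces computed from a spanning family with coordinate forms *)

Section Trace.
Import VectorInternalTheory.
Local Open Scope ring_scope.

(** Here [f] is the sum of the rank-one maps [x |-> c i x *: f (e i)], and such a map has trace
    [c i (f (e i))]. *)
Lemma ltrace_basis (R : comNzRingType) (L : freeLieAlgType R) (I : finType)
    (e : I -> L) (c : I -> L -> R) (f : {linear L -> L}) :
    (forall i, scalar (c i)) -> (forall x, x = \sum_i c i x *: e i) ->
  ltrace f = \sum_i c i (f (e i)).
Proof.
move=> c_lin eK; rewrite /ltrace /mxtrace.
pose C i := GRing.isLinear.Build _ _ _ _ (c i) (c_lin i).
pose c' i : {linear L -> R | *%R} := HB.pack (c i) (C i).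
transitivity (\sum_t \sum_i c i (r2v (delta_mx 0 t)) * v2r (f (e i)) 0 t).
  apply: eq_bigr => t _; rewrite mxE /= [in LHS](eK (r2v _)) !linear_sum /=.
  by rewrite summxE; apply: eq_bigr => i _; rewrite !linearZ /= mxE.
rewrite exchange_big; apply: eq_bigr => i _ /=.
rewrite -[in RHS](v2rK (f (e i))) [in RHS](row_sum_delta (v2r _)).
rewrite linear_sum -[c i _]/(c' i _) linear_sum.
by apply: eq_bigr => t _; rewrite !linearZ /= mulrC.
Qed.

End Trace.

(** * Skew-symmetric matrices with prescribed support *)

Section SupportedMatrices.
Import boolp classical_sets.
Local Open Scope ring_scope.
Local Open Scope classical_set_scope.

(** Entrywise form of the [H'_k], which avoids handling the coefficients of a span; [lspan_soX]
    shows that the two descriptions agree. *)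
Definition so_supported (R : nzRingType) (m : nat) (e : rel 'I_m) :
    set (so R m) :=
  [set x : so R m | forall i j, ~~ e i j -> x i j = 0].

Lemma so_diag (R : nzRingType) (m : nat) (x : so R m) i : x i i = 0.
Proof. exact: (so_span_alt (valP x)).1. Qed.

Lemma so_skew (R : nzRingType) (m : nat) (x : so R m) i j : x j i = - x i j.
Proof. exact: (so_span_alt (valP x)).2. Qed.

Lemma XmxE (R : nzRingType) (m : nat) (i j a b : 'I_m) :
  Xmx R i j a b = ((a == i) && (b == j))%:R - ((a == j) && (b == i))%:R.
Proof. by rewrite !mxE. Qed.

Lemma Xmx_in_so (R : nzRingType) (m : nat) (i j : 'I_m) :
  Xmx R i j \in @so_span R m.
Proof.
apply/so_spanP; split=> [a|a b]; rewrite !XmxE.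
  by rewrite andbC subrr.
by rewrite opprB andbC [(b == j) && _]andbC.
Qed.

Definition soX (R : nzRingType) (m : nat) (i j : 'I_m) : so R m :=
  So (Xmx_in_so R i j).

Lemma so_mx_sum (R : nzRingType) (m : nat) (I : finType) (F : I -> so R m) i j :
  (\sum_k F k) i j = \sum_k F k i j.
Proof.
rewrite -summxE; congr (fun_of_matrix _ i j).
by elim/big_rec2: _ => // k _ y _ <-.
Qed.

(** This is the expansion that [ltrace_basis] asks for: the coordinates are the entries above the
    diagonal. *)
Lemma so_sumX (R : nzRingType) (m : nat) (x : so R m) :
  x = \sum_(p : so_index m) x (val p).1 (val p).2 *: soX R (val p).1 (val p).2.
Proof.
have [x0 xN] := so_span_alt (valP x).
have xE : so_mx x = so_comb (so_coord x).
  apply: so_coord_inj => //; first exact: so_comb_in.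
  by apply/ffunP=> p; rewrite so_combK.
apply: val_inj; apply/matrixP=> i j; rewrite /= [in LHS]xE so_mx_sum summxE.
by apply: eq_bigr => p _; rewrite ffunE.
Qed.

Lemma mul_XmxE (R : comNzRingType) (m : nat) (A : 'M[R]_m) (i j a b : 'I_m) :
  (A *m Xmx R i j) a b = A a i * (b == j)%:R - A a j * (b == i)%:R.
Proof.
rewrite mulmxBr !mxE; congr (_ - _).
  rewrite (bigD1 i) //= big1 ?addr0 ?mxE ?eqxx // => k /negbTE ki.
  by rewrite mxE ki mulr0.
rewrite (bigD1 j) //= big1 ?addr0 ?mxE ?eqxx // => k /negbTE kj.
by rewrite mxE kj mulr0.
Qed.

Lemma Xmx_mulE (R : comNzRingType) (m : nat) (A : 'M[R]_m) (i j a b : 'I_m) :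
  (Xmx R i j *m A) a b = (a == i)%:R * A j b - (a == j)%:R * A i b.
Proof.
rewrite mulmxBl !mxE; congr (_ - _).
  rewrite (bigD1 j) //= big1 ?addr0 ?mxE ?eqxx ?andbT // => k /negbTE kj.
  by rewrite mxE kj andbF mul0r.
rewrite (bigD1 i) //= big1 ?addr0 ?mxE ?eqxx ?andbT // => k /negbTE ki.
by rewrite mxE ki andbF mul0r.
Qed.

(** Since diagonal entries are zero, skew-symmetry brings every remaining term of the trace to the
    form [x a b * y a b] up to sign, so the terms vanish one by one. *)
Lemma killing_disjoint_support (R : comNzRingType) (m : nat) (x y : so R m) :
  (forall i j, x i j * y i j = 0) -> killing x y = 0.
Proof.
move=> xy0; rewrite /killing.
have f_lin : linear (ad x \o ad y).
  by move=> a u v; rewrite /= /ad !bracket_linearr.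
pose F := GRing.isLinear.Build _ _ _ _ (ad x \o ad y) f_lin.
pose f : {linear so R m -> so R m} := HB.pack (ad x \o ad y) F.
pose c (p : so_index m) (z : so R m) := z (val p).1 (val p).2.
rewrite -[ad x \o ad y]/(f : _ -> _).
rewrite (@ltrace_basis _ _ _ (fun p => soX R (val p).1 (val p).2) c).
- apply: big1 => -[[p q] /= ltpq] _; set X := Xmx R p q.
  (* The coordinate splits into four triple products: [e1] and [e4] are diagonal entries of [x *m y]
     and [y *m x], while [e2] and [e3] reduce to [- (x p q * y p q)]. *)
  change ((x *m (y *m X - X *m y) - (y *m X - X *m y) *m x) p q = 0).
  rewrite {}/X.
  have qp : (q == p) = false by apply: contraTF ltpq => /eqP->; rewrite ltnn.
  have xyN a b : x a b * y b a = 0 by rewrite (so_skew y) mulrN xy0 oppr0.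
  rewrite (mulmxBr x) (mulmxBl _ _ x) -!mulmxA.
  have diag (u v : so R m) a : (forall b, u a b * v b a = 0) ->
      (so_mx u *m so_mx v) a a = 0.
    by move=> uv0; rewrite mxE big1.
  have e1 : (so_mx x *m (so_mx y *m Xmx R p q)) p q = 0.
    rewrite mulmxA mul_XmxE eqxx qp mulr1 mulr0 subr0.
    exact: diag.
  have e2 : (so_mx x *m (Xmx R p q *m so_mx y)) p q = 0.
    rewrite mulmxA mxE big1 // => b _; rewrite mul_XmxE so_diag mul0r sub0r.
    case: (eqVneq b p) => [->|_]; last by rewrite mulr0 oppr0 mul0r.
    by rewrite mulr1 mulNr xy0 oppr0.
  have e3 : (so_mx y *m (Xmx R p q *m so_mx x)) p q = 0.
    rewrite mulmxA mxE big1 // => b _; rewrite mul_XmxE so_diag mul0r sub0r.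
    case: (eqVneq b p) => [->|_]; last by rewrite mulr0 oppr0 mul0r.
    by rewrite mulr1 mulNr mulrC xy0 oppr0.
  have e4 : (Xmx R p q *m (so_mx y *m so_mx x)) p q = 0.
    rewrite Xmx_mulE eqxx eq_sym qp mul1r mul0r subr0.
    by apply: diag => b; rewrite mulrC.
  have subE (P Q : 'M[R]_m) : (P - Q) p q = P p q - Q p q by rewrite !mxE.
  by rewrite !subE e1 e2 e3 e4 !subrr.
- by move=> p a u v; rewrite /c /= !mxE.
exact: so_sumX.
Qed.

Lemma killing_so_supported (R : comNzRingType) (m : nat) (e f : rel 'I_m)
    (x y : so R m) :
    (forall i j, e i j -> ~~ f i j) -> so_supported e x -> so_supported f y ->
  killing x y = 0.
Proof.
move=> ef xe yf; apply: killing_disjoint_support => i j.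
have [/ef/yf->|/xe->] := boolP (e i j); first by rewrite mulr0.
by rewrite mul0r.
Qed.

Lemma so_supported_submod (R : nzRingType) (m : nat) (e : rel 'I_m) :
  submod_closed [in so_supported (R := R) e].
Proof.
split=> [|a x y]; rewrite !inE; first by move=> i j _; rewrite mxE.
by move=> xe ye i j ij; rewrite !mxE xe // ye // mulr0 addr0.
Qed.

Lemma soX_supported (R : nzRingType) (m : nat) (e : rel 'I_m) i j :
  symmetric e -> e i j -> so_supported e (soX R i j).
Proof.
move=> e_sym eij a b ab; rewrite [LHS]XmxE.
case: (eqVneq a i) (eqVneq b j) => [ai|_] [bj|_] /=;
  try by move: ab; rewrite ai bj eij.
all: case: (eqVneq a j) (eqVneq b i) => [aj|_] [bi|_] /=; rewrite ?subrr //.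
all: by move: ab; rewrite aj bi e_sym eij.
Qed.

(** In the expansion [so_sumX] the coefficients off [e] vanish, so only generators remain.
    Conversely, [X_(i,j)] also occupies [(j, i)], whence the symmetry of [e]. *)
Lemma lspan_soX (R : nzRingType) (m : nat) (e : rel 'I_m) :
    symmetric e -> irreflexive e ->
  lspan [set x : so R m | exists i j, e i j /\ so_mx x = Xmx R i j]
    = so_supported e.
Proof.
move=> e_sym e_irr; set S := [set x | _]; apply/seteqP; split=> x.
  case=> n [c [v [Sv ->]]] i j nij; rewrite so_mx_sum big1 // => k _.
  have [a [b [eab vE]]] := Sv k.
  have -> : v k = soX R a b by apply: val_inj.
  by rewrite mxE (soX_supported R e_sym eab nij) mulr0.
move=> xe; have [S0 Slin] := lspan_submod_closed S.
suff: x \in lspan S by rewrite inE.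
rewrite (so_sumX x); elim/big_rec: _ => // p y _ yS.
have [ep|/xe->] := boolP (e (val p).1 (val p).2); last by rewrite scale0r add0r.
by apply: Slin yS; apply: lspan_gen; exists (val p).1, (val p).2.
Qed.

(** A nonzero term [u i a * v a j] makes [i] and [j] both partners of [a], so products are diagonal;
    the bracket, being skew, has zero diagonal too. *)
Lemma so_supported_abelian (R : comNzRingType) (m : nat) (e : rel 'I_m) :
    symmetric e -> (forall i a b, e i a -> e i b -> a = b) ->
  lie_abelian (so_supported (R := R) e).
Proof.
move=> e_sym e_uniq x y xe ye; apply: val_inj; apply/matrixP=> i j.
have [->|ij] := eqVneq i j; first by rewrite !so_diag.
have mul0 (u v : so R m) : so_supported e u -> so_supported e v ->
    (so_mx u *m so_mx v) i j = 0.
  move=> ue ve; rewrite mxE big1 // => a _.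
  have [eia|/ue->] := boolP (e i a); last by rewrite mul0r.
  have [eaj|/ve->] := boolP (e a j); last by rewrite mulr0.
  by case/eqP: ij; apply: e_uniq eaj; rewrite e_sym.
by move: (mul0 _ _ xe ye) (mul0 _ _ ye xe); rewrite !mxE => -> ->; rewrite subrr.
Qed.

Lemma lie_abelian_nilpotent (R : comNzRingType) (L : lieAlgType R) (H : set L) :
  lie_abelian H -> lie_nilpotent H.
Proof.
move=> Hab; exists 1%N; apply/seteqP; split=> z /=.
  case=> n [c [v [vH ->]]]; apply: big1 => i _.
  by have [x [y [Hx Hy ->]]] := vH i; rewrite Hab ?scaler0.
by move=> ->; exists 0%N, (fun=> 0), (fun=> 0); split; [case | rewrite big_ord0].
Qed.

(** Bracketing with [X_(j,i)] carries row [j] of [x] to row [i]. This treats every row but that of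
    [k], which then follows by skew-symmetry. *)
Lemma so_supported_cartan (R : comNzRingType) (m : nat) (e : rel 'I_m)
    (k : 'I_m) :
    symmetric e -> irreflexive e -> (forall i a b, e i a -> e i b -> a = b) ->
    (forall j, j != k -> exists i, e j i) ->
  cartan_subalgebra (so_supported (R := R) e).
Proof.
move=> e_sym e_irr e_uniq e_cov.
have Hab := so_supported_abelian (R := R) e_sym e_uniq.
have Hsub := so_supported_submod R e.
have H0 : so_supported (R := R) e 0 by have [] := Hsub; rewrite inE.
split; [split=> // x y xe ye | exact: lie_abelian_nilpotent | ].
  by rewrite Hab.
apply/seteqP; split=> x; last by move=> xe y ye; rewrite Hab.
move=> xN.
have row0 j b : j != k -> ~~ e j b -> x j b = 0.
  move=> /e_cov[i eji] njb.
  have [<-|jb] := eqVneq j b; first exact: so_diag.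
  have ib : b != i by apply: contraNneq njb => ->.
  have nib : ~~ e i b.
    by apply: contra jb => eib; apply/eqP/(e_uniq i)=> //; rewrite e_sym.
  (* As [b] differs from [i] and [j], the entry [(i, b)] of [[x, X_(j,i)]] is exactly [x j b]. *)
  have := xN _ (soX_supported R e_sym eji) i b nib.
  have ij : i != j by apply: contraTneq eji => ->; rewrite e_irr.
  rewrite so_bracketE [LHS]mxE [X in _ + X]mxE mul_XmxE Xmx_mulE.
  rewrite (negbTE ib) (negbTE ij) eqxx [b == j]eq_sym (negbTE jb).
  by rewrite !mulr0 !mul0r subrr !sub0r mul1r opprK.
move=> i j nij; have [ik|/row0->//] := eqVneq i k.
have [jk|jk] := eqVneq j k; first by rewrite ik jk so_diag.
by rewrite so_skew row0 ?oppr0 // e_sym.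
Qed.

(** The component of index [k] is [x] cut down to [e k]. At an off-diagonal position of [e k] all
    other components vanish, which forces this choice. *)
Lemma so_supported_direct_sum (R : comNzRingType) (m : nat) (I : finType)
    (e : I -> rel 'I_m) :
    (forall k, symmetric (e k)) ->
    (forall i j, i != j -> exists2 k, e k i j & forall l, e l i j -> l = k) ->
  direct_sum_decomposition (fun k => so_supported (R := R) (e k)).
Proof.
move=> e_sym e_part x.
have r_in k : (\matrix_(i, j) if e k i j then x i j else 0) \in @so_span R m.
  apply/so_spanP; split=> [i|i j]; rewrite !mxE ?so_diag ?if_same //.
  by rewrite e_sym so_skew; case: ifP; rewrite ?oppr0.
exists [ffun k => So (r_in k)]; split=> [|h [h_supp xE]].
  split=> [k i j /negbTE nij|]; first by rewrite ffunE mxE nij.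
  apply: val_inj; apply/matrixP=> i j; rewrite so_mx_sum.
  under eq_bigr => k _ do rewrite ffunE mxE.
  have [->|ij] := eqVneq i j; first by rewrite so_diag big1 // => k; rewrite if_same.
  have [k kij k_uniq] := e_part i j ij; rewrite (bigD1 k) //= kij big1 ?addr0 //.
  by move=> l lk; case: ifP => // /k_uniq lE; rewrite lE eqxx in lk.
apply/ffunP=> k; apply: val_inj; apply/matrixP=> i j; rewrite ffunE mxE.
case: ifPn => [kij|nij]; last by rewrite h_supp.
have [->|ij] := eqVneq i j; first by rewrite !so_diag.
have [k' _ k'_uniq] := e_part i j ij.
rewrite xE so_mx_sum (bigD1 k) //= big1 ?addr0 // => l lk; apply: h_supp.
by apply: contra lk => lij; rewrite (k'_uniq l) // (k'_uniq k).
Qed.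

End SupportedMatrices.

(** * Matchings and the relations they induce on matrix indices *)

Lemma set2_injr (T : finType) (a b c : T) : [set a; b] = [set a; c] -> b = c.
Proof.
move=> E; have: b \in [set a; c] by rewrite -E set22.
have: c \in [set a; b] by rewrite E set22.
by rewrite !inE => /orP[]/eqP-> // /orP[]/eqP.
Qed.

Section PairRelation.

Variables (m : nat) (M : 'I_m -> {set {set 'I_m.+1}}).

(** This is the relation [~k]; living on ['I_m], it leaves out any pair through [ord_max]. *)
Definition pair_rel (k : 'I_m) : rel 'I_m :=
  fun i j => [set pt i; pt j] \in M k.

Lemma pair_rel_sym k : symmetric (pair_rel k).
Proof. by move=> i j; rewrite /pair_rel setUC. Qed.

Lemma pt_neq_last (i : 'I_m) : (pt i == ord_max) = false.
Proof. by rewrite eq_sym; apply/negbTE/neq_lift. Qed.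

Lemma pt_inj : injective (@pt m).
Proof. exact: lift_inj. Qed.

(** The pair removed in [Mprime] contains [ord_max], so no pair of matrix indices is lost. *)
Lemma mem_Mprime k i j : ([set pt i; pt j] \in Mprime M k) = pair_rel k i j.
Proof.
rewrite !inE andbC -/(pair_rel k i j); case: (pair_rel k i j) => //=.
apply/eqP=> E; have: ord_max \in [set pt i; pt j] by rewrite E set22.
by rewrite !inE ![ord_max == _]eq_sym !pt_neq_last.
Qed.

Hypothesis M_pairs : forall k a, a \in M k -> #|a| = 2.
Hypothesis M_disjoint : forall k (a b : {set 'I_m.+1}),
  a \in M k -> b \in M k -> a != b -> [disjoint a & b].

Lemma M_meet k (a b : {set 'I_m.+1}) p :
  a \in M k -> b \in M k -> p \in a -> p \in b -> a = b.
Proof.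
move=> aM bM pa pb; apply/eqP; apply: contraTT pb => ab.
by rewrite (disjointFr (M_disjoint aM bM ab) pa).
Qed.

Lemma pair_rel_irr k : irreflexive (pair_rel k).
Proof.
by move=> i; apply/negP=> /M_pairs; rewrite setUid cards1.
Qed.

Lemma pair_rel_uniq k i a b : pair_rel k i a -> pair_rel k i b -> a = b.
Proof.
move=> ia ib; apply/pt_inj/(@set2_injr _ (pt i)).
by apply: (M_meet ia ib (p := pt i)); rewrite set21.
Qed.

Hypothesis M_last : forall k, [set pt k; ord_max] \in M k.

(** By counting, the disjoint pairs of [M k] exhaust all [m.+1] points, so [pt j] has a partner; it
    is not [ord_max], whose partner is [pt k]. *)
Lemma pair_rel_cover k j :
  m.+1 = #|M k| * 2 -> j != k -> exists i, pair_rel k j i.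
Proof.
move=> M_card jk.
have trivM : trivIset (M k) by apply/trivIsetP=> a b; exact: M_disjoint.
have covM : cover (M k) = [set: 'I_m.+1].
  apply/eqP; rewrite eqEcard subsetT cardsT card_ord -(eqP trivM) /=.
  by rewrite (eq_bigr (fun=> 2)) ?sum_nat_const -?M_card // => a /M_pairs.
have: pt j \in cover (M k) by rewrite covM inE.
case/bigcupP=> a aM ja.
have /eqP/cards2P[p [q [pq aE]]] := M_pairs aM.
have [y aEy] : exists y, a = [set pt j; y].
  move: ja; rewrite aE !inE => /orP[]/eqP->; first by exists q.
  by exists p; rewrite setUC.
case: (unliftP ord_max y) => [i yi|yi]; first by exists i; rewrite /pair_rel /pt -yi -aEy.
have a_last : a = [set pt k; ord_max].
  by apply: (M_meet aM (M_last k) (p := ord_max)); rewrite ?aEy ?yi !inE eqxx orbT.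
by move: ja; rewrite a_last !inE pt_neq_last orbF => /eqP/pt_inj jE; rewrite jE eqxx in jk.
Qed.

(** The partition hypothesis sees only the set of blocks, not their indices; the partner of
    [ord_max] recovers the index. *)
Lemma M_inj : injective M.
Proof.
move=> k l E; apply/pt_inj/(@set2_injr _ ord_max).
have lM : [set pt l; ord_max] \in M k by rewrite E.
rewrite !(setUC [set ord_max]).
by apply: (M_meet (M_last k) lM (p := ord_max)); rewrite set22.
Qed.

Lemma pair_rel_partition i j :
    partition [set M k | k : 'I_m] [set e : {set 'I_m.+1} | #|e| == 2] ->
    i != j ->
  exists2 k, pair_rel k i j & forall l, pair_rel l i j -> l = k.
Proof.
case/and3P=> /eqP covM trivM _ ij.
have: [set pt i; pt j] \in cover [set M k | k : 'I_m].
  by rewrite covM inE cards2 (inj_eq pt_inj) ij.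
case/bigcupP=> _ /imsetP[k _ ->] kij; exists k => // l lij; apply: M_inj.
(* Both [M k] and [M l] are the block containing the pair. *)
rewrite -(def_pblock trivM _ kij) ?imset_f //.
by rewrite -(def_pblock trivM _ lij) ?imset_f.
Qed.

End PairRelation.

Theorem theorem4p3 (R : finComNzRingType) (c : nat)
    (char_R : has_char R c) (odd_c : odd c)
    (n : nat) (n_ge2 : 2 <= n)
    (M : 'I_(2 * n - 1) -> {set {set 'I_(2 * n - 1).+1}})
    (M_partition : partition [set M k | k : 'I_(2 * n - 1)]
                     [set e : {set 'I_(2 * n - 1).+1} | #|e| == 2])
    (M_card : forall k, #|M k| = n)
    (M_disjoint : forall k (a b : {set 'I_(2 * n - 1).+1}),
       a \in M k -> b \in M k -> a != b -> [disjoint a & b])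
    (M_last : forall k, [set pt k; ord_max] \in M k) :
  is_ODAC (L := so R (2 * n - 1)) (Hprime M (R := R)).
Proof.
have M_pairs k a : a \in M k -> #|a| = 2.
  move=> aM; have /and3P[/eqP covM _ _] := M_partition.
  have: a \in cover [set M k | k : 'I_(2 * n - 1)].
    by apply/bigcupP; exists (M k); rewrite ?imset_f.
  by rewrite covM inE => /eqP.
have e_sym := pair_rel_sym M.
have e_irr := pair_rel_irr M_pairs.
have e_uniq k := @pair_rel_uniq _ _ M_disjoint k.
have e_part i j := @pair_rel_partition _ _ M_disjoint M_last i j M_partition.
have -> : Hprime M (R := R) = fun k => so_supported (R := R) (pair_rel M k).
  apply/boolp.funext=> k; rewrite -(lspan_soX R (e_sym k) (e_irr k)); congr lspan.
  by apply/classical_sets.seteqP; split=> x [i [j [ij xE]]]; exists i, j; move: ij;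
    rewrite mem_Mprime.
(* The subtraction is truncated, so positivity of [n] enters here; [pair_rel_cover] needs this count
   of points. *)
have dim : (2 * n - 1).+1 = n * 2.
  by rewrite subn1 prednK 1?mulnC // muln_gt0 (ltnW n_ge2).
split.
- exact: so_supported_direct_sum.
- move=> k; apply: (@so_supported_cartan _ _ _ k) => //; first exact: e_uniq.
  by move=> j; apply: pair_rel_cover => //; rewrite M_card.
- by move=> k; apply: so_supported_abelian (e_sym k) (e_uniq k).
move=> k l kl x y xH yH; apply: (killing_so_supported _ xH yH) => i j kij.
(* A position common to both supports would be off-diagonal, hence in a single relation, against
   [k != l]. *)
have ij : i != j by apply: contraTneq kij => ->; rewrite e_irr.
have [k' _ uk'] := e_part i j ij.
by apply: contra kl => lij; rewrite (uk' k kij) (uk' l lij).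
Qed.
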